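(* For all positive integers $r,n$, the following identity holds in $\mathbb{Z}[[z_0,\ldots,z_n]]$: \[ \sum_{ k \ge 0 } \prod_{ j=1 }^n [k+1]_{ z_j } \, z_0^k \ = \ \sum_{\pi\in S_n} \sum_{(\rho,\epsilon)\in I_{r,n}} \frac{\displaystyle \prod_{j\in \mathrm{Des}(\pi)} z_0z_{\pi(1)}z_{\pi(2)}\cdots z_{\pi(j)} \prod_{j\in \mathrm{NNeg}((\rho,\epsilon)^{-1})} z_0z_{\pi(1)}z_{\pi(2)}\cdots z_{\pi(j)} }{\displaystyle (1-z_0)\prod_{j=1}^n \left(1-z_0^r z_{\pi(1)}^r\cdots z_{\pi(j)}^r \right) } \, , \] where the second product in the numerator runs over the multiset $\mathrm{NNeg}((\rho,\epsilon)^{-1})$ with multiplicity (each $j$ contributing as many factors as its multiplicity).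
   Context: $[m]_z=1+z+\cdots+z^{m-1}$. For $\pi\in S_n$, $\mathrm{Des}(\pi)=\{j\in[n-1]:\pi(j)>\pi(j+1)\}$. Let $\omega=e^{2\pi i/r}$. The wreath product $\mathbb{Z}_r\wr S_n$ consists of pairs $(\pi,\epsilon)$ with $\pi\in S_n$, $\epsilon_j=\omega^{c_j}$, $c_j\in\{0,\ldots,r-1\}$ (colors). Identify $(\pi,\epsilon)$ with the $n\times n$ matrix with entry $\epsilon_i$ in position $(\pi(i),i)$ and zeros elsewhere; group operation and inverses are matrix multiplication and matrix inverse. Window notation: $[\pi(1)^{c_1}\cdots\pi(n)^{c_n}]$. Totally order pairs $j^{c}$ by $j^{c}<k^{d}$ if $c>d$, or $c=d$ and $j<k$. $\mathrm{Des}_A(\pi,\epsilon)=\{i\in[n-1]:\pi(i)^{c_i}>\pi(i+1)^{c_{i+1}}\}$, and $I_{r,n}$ is the set of elements with $\mathrm{Des}_A=\emptyset$. For $(\sigma,\delta)$ with colors $d_i$, $\mathrm{NNeg}(\sigma,\delta)$ is the multiset containing each $i\in[n]$ with multiplicity $d_i$; equivalently, $\mathrm{NNeg}((\rho,\epsilon)^{-1})$ contains $\rho(i)$ with multiplicity $(r-c_i)\bmod r$. *)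

(* Defs.v *)
From HB Require Import structures.
From mathcomp Require Import all_boot all_order all_algebra all_fingroup.
From mathcomp Require Import boolp mpoly.

Set Implicit Arguments.
Unset Strict Implicit.
Unset Printing Implicit Defensive.

Import GRing.Theory.

Local Open Scope ring_scope.

(* Formal power series in n variables over R, as families of coefficients
   indexed by the exponent vectors 'X_{1..n}.  The product is the Cauchy
   product; a series is a unit iff its constant coefficient is.               *)
Record mfps (n : nat) (R : Type) := MFps { mfcoef : 'X_{1.. n} -> R }.

HB.instance Definition _ (n : nat) (R : Type) := gen_eqMixin (mfps n R).
HB.instance Definition _ (n : nat) (R : Type) := gen_choiceMixin (mfps n R).

Lemma mfpsP (n : nat) (R : Type) (f g : mfps n R) : mfcoef f =1 mfcoef g <-> f = g.
Proof. by split=> [|-> //]; case: f g => [f] [g] /= /funext ->. Qed.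

Section Zmod.
Variables (n : nat) (R : zmodType).
Implicit Types f g : mfps n R.

Definition mfzero : mfps n R := MFps (fun=> 0).
Definition mfopp f := MFps (fun m => - mfcoef f m).
Definition mfadd f g := MFps (fun m => mfcoef f m + mfcoef g m).

Fact mfaddA : associative mfadd.
Proof. by move=> f g h; apply/mfpsP => m /=; rewrite addrA. Qed.
Fact mfaddC : commutative mfadd.
Proof. by move=> f g; apply/mfpsP => m /=; rewrite addrC. Qed.
Fact mfadd0 : left_id mfzero mfadd.
Proof. by move=> f; apply/mfpsP => m /=; rewrite add0r. Qed.
Fact mfaddN : left_inverse mfzero mfopp mfadd.
Proof. by move=> f; apply/mfpsP => m /=; rewrite addNr. Qed.

HB.instance Definition _ :=
  GRing.isZmodule.Build (mfps n R) mfaddA mfaddC mfadd0 mfaddN.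

Lemma mfcoef0 m : mfcoef (0 : mfps n R) m = 0. Proof. by []. Qed.
Lemma mfcoefN f m : mfcoef (- f) m = - mfcoef f m. Proof. by []. Qed.
Lemma mfcoefD f g m : mfcoef (f + g) m = mfcoef f m + mfcoef g m.
Proof. by []. Qed.
Lemma mfcoefB f g m : mfcoef (f - g) m = mfcoef f m - mfcoef g m.
Proof. by []. Qed.
Lemma mfcoef_sum (I : Type) (r : seq I) (P : pred I) (F : I -> mfps n R) m :
  mfcoef (\sum_(i <- r | P i) F i) m = \sum_(i <- r | P i) mfcoef (F i) m.
Proof. by elim/big_rec2: _ => // i x y _ <-. Qed.

End Zmod.

Section ComRing.
Variables (n : nat) (R : comNzRingType).
Implicit Types f g h : mfps n R.

Definition mfconst (c : R) : mfps n R := MFps (fun m => c *+ (m == 0%MM)).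
Definition mfvar (i : 'I_n) : mfps n R := MFps (fun m => (m == U_(i)%MM)%:R).

Definition mfmul f g : mfps n R :=
  MFps (fun m =>
    \sum_(k : 'X_{1..n < (mdeg m).+1, (mdeg m).+1} | m == (k.1 + k.2)%MM)
      mfcoef f k.1 * mfcoef g k.2).

Definition mftrunc (d : nat) f : {mpoly R[n]} :=
  \sum_(m : 'X_{1..n < d}) mfcoef f m *: 'X_[m].

Lemma mftruncE d f m : (mdeg m < d)%N -> (mftrunc d f)@_m = mfcoef f m.
Proof. exact: mcoeff_mpoly. Qed.

Lemma eq_mcoeffM (p p' q q' : {mpoly R[n]}) m :
  (forall k, (mdeg k <= mdeg m)%N -> p@_k = p'@_k) ->
  (forall k, (mdeg k <= mdeg m)%N -> q@_k = q'@_k) ->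
  (p * q)@_m = (p' * q')@_m.
Proof.
move=> Ep Eq; rewrite !mcoeffM; apply: eq_bigr => -[k1 k2] _ /=.
by rewrite Ep ?Eq // -ltnS bmdeg.
Qed.

Lemma mfcoef_mul d f g m : (mdeg m < d)%N ->
  mfcoef (mfmul f g) m = (mftrunc d f * mftrunc d g)@_m.
Proof.
move=> lt_md; rewrite mcoeffM /=; apply: eq_bigr => -[k1 k2] _ /=.
by rewrite !mftruncE // (leq_trans (bmdeg _)).
Qed.

Lemma mftrunc_mul d f g m : (mdeg m < d)%N ->
  (mftrunc d (mfmul f g))@_m = (mftrunc d f * mftrunc d g)@_m.
Proof. by move=> lt_md; rewrite mftruncE // (mfcoef_mul _ _ lt_md). Qed.

Fact mfmulA : associative mfmul.
Proof.
move=> f g h; apply/mfpsP => m; rewrite !(mfcoef_mul _ _ (ltnSn (mdeg m))).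
transitivity ((mftrunc (mdeg m).+1 f *
               (mftrunc (mdeg m).+1 g * mftrunc (mdeg m).+1 h))@_m).
  by apply: eq_mcoeffM => // k le_km; rewrite mftrunc_mul.
by rewrite mulrA; apply: eq_mcoeffM => // k le_km; rewrite mftrunc_mul.
Qed.

Fact mfmulC : commutative mfmul.
Proof.
by move=> f g; apply/mfpsP => m; rewrite !(mfcoef_mul _ _ (ltnSn (mdeg m))) mulrC.
Qed.

Fact mfmul1 : left_id (mfconst 1) mfmul.
Proof.
move=> f; apply/mfpsP => m; rewrite (mfcoef_mul _ _ (ltnSn (mdeg m))).
rewrite -[RHS](mftruncE _ (ltnSn (mdeg m))) -[in RHS](mul1r (mftrunc _ f)).
by apply: eq_mcoeffM => // k le_km; rewrite mftruncE // mcoeff1.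
Qed.

Fact mfmulDl : left_distributive mfmul +%R.
Proof.
move=> f g h; apply/mfpsP => m /=; rewrite -big_split /=.
by apply: eq_bigr => k _; rewrite mulrDl.
Qed.

Fact mfone_neq0 : mfconst 1 != 0.
Proof.
by apply/eqP => /mfpsP /(_ 0%MM) /=; rewrite eqxx => /eqP; rewrite oner_eq0.
Qed.

HB.instance Definition _ := GRing.Zmodule_isComNzRing.Build (mfps n R)
  mfmulA mfmulC mfmul1 mfmulDl mfone_neq0.

Lemma mfcoef1 m : mfcoef (1 : mfps n R) m = (m == 0%MM)%:R.
Proof. by []. Qed.

Lemma mfcoefM f g m :
  mfcoef (f * g) m =
  \sum_(k : 'X_{1..n < (mdeg m).+1, (mdeg m).+1} | m == (k.1 + k.2)%MM)
    mfcoef f k.1 * mfcoef g k.2.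
Proof. by []. Qed.

Lemma mfcoefM0 f g : mfcoef (f * g) 0%MM = mfcoef f 0%MM * mfcoef g 0%MM.
Proof.
have z (k : 'X_{1..n < (mdeg (0%MM : 'X_{1..n})).+1}) : k = 0%MM :> 'X_{1..n}.
  by apply/eqP; rewrite -mdeg_eq0 -leqn0 -[leqRHS](@mdeg0 n) -ltnS bmdeg.
rewrite mfcoefM (bigD1 (bm0, bm0)) /= ?addm0 // big1 ?addr0 // => -[k1 k2] /=.
case/andP=> _ /eqP []; congr (_, _); apply: val_inj; exact: z.
Qed.

Lemma mfcoefCM c f m : mfcoef (mfconst c * f) m = c * mfcoef f m.
Proof.
rewrite [LHS](mfcoef_mul _ _ (ltnSn (mdeg m))).
have -> : mftrunc (mdeg m).+1 (mfconst c) = c%:MP.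
  apply/mpolyP => k; rewrite mcoeffC.
  have [lt_k|ge_k] := ltnP (mdeg k) (mdeg m).+1.
    by rewrite mftruncE //= mulr_natr.
  rewrite -mdeg_eq0 (gtn_eqF (leq_trans _ ge_k)) // mulr0.
  rewrite raddf_sum big1 // => -[i lt_i] _ /=.
  rewrite mcoeffZ mcoeffX; case: (i =P k) => [E|]; rewrite ?mulr0 //.
  by move: ge_k; rewrite -E leqNgt lt_i.
by rewrite mcoeffCM mftruncE.
Qed.

Lemma mfcoefX_eq0 f k m :
  mfcoef f 0%MM = 0 -> (mdeg m < k)%N -> mfcoef (f ^+ k) m = 0.
Proof.
move=> f0; elim: k m => // k IHk m lt_mk; rewrite exprS mfcoefM big1 //.
case=> k1 k2 /= /eqP E; have [->|nz] := eqVneq (k1 : 'X_{1.. n}) 0%MM.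
  by rewrite f0 mul0r.
have lt_k2m : (mdeg k2 < mdeg m)%N.
  rewrite [X in (_ < mdeg X)%N](_ : _ = (k1 + k2)%MM) // mdegD -add1n leq_add2r.
  by rewrite lt0n mdeg_eq0.
by rewrite IHk ?mulr0 // (leq_trans lt_k2m).
Qed.

End ComRing.

Arguments mfvar {n R} i.

Section ComUnitRing.
Variables (n : nat) (R : comUnitRingType).
Implicit Types f g : mfps n R.

Definition mfunit : {pred mfps n R} :=
  fun f => mfcoef f 0%MM \is a GRing.unit.

(* With u the constant coefficient of f and h = 1 - f / u, the inverse of f is
   (\sum_k h ^+ k) / u, and h ^+ k has no term of degree less than k.         *)
Definition mfinv f : mfps n R :=
  if f \in mfunit then
    let c := (mfcoef f 0%MM)^-1 in
    MFps (fun m => mfcoef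
      (mfconst n c * \sum_(k < (mdeg m).+1) (1 - mfconst n c * f) ^+ k) m)
  else f.

Fact mfmulV : {in mfunit, left_inverse 1 mfinv *%R}.
Proof.
move=> f Uf; rewrite /mfinv Uf; set c := _^-1; set h := 1 - _.
have h0 : mfcoef h 0%MM = 0.
  by rewrite mfcoefB mfcoef1 eqxx mfcoefCM mulVr ?subrr.
have Ecf : mfconst n c * f = 1 - h by rewrite opprB addrC subrK.
apply/mfpsP => m.
have Ek (k : 'X_{1.. n}) : (mdeg k <= mdeg m)%N ->
    mfcoef (mfconst n c * \sum_(i < (mdeg k).+1) h ^+ i) k =
    mfcoef (mfconst n c * \sum_(i < (mdeg m).+1) h ^+ i) k.
  move=> le_km; rewrite !mfcoefCM; congr (_ * _); rewrite !mfcoef_sum.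
  rewrite -!(big_mkord xpredT (fun i => mfcoef (h ^+ i) k)).
  rewrite [RHS](@big_cat_nat _ _ _ (mdeg k).+1) //=.
  rewrite -[LHS]addr0; congr (_ + _); rewrite big_nat_cond big1 //.
  by move=> i /andP[/andP[lt_i _] _]; apply: mfcoefX_eq0.
transitivity (mfcoef ((mfconst n c * \sum_(k < (mdeg m).+1) h ^+ k) * f) m).
  rewrite !mfcoefM; apply: eq_bigr => -[k1 k2] _; congr (_ * _).
  by apply: Ek; rewrite -ltnS bmdeg.
rewrite mulrAC Ecf -opprB mulNr -subrX1 opprB mfcoefB.
by rewrite (mfcoefX_eq0 h0) // subr0.
Qed.

Fact mfunitPl f g : g * f = 1 -> mfunit f.
Proof.
move=> E; apply/unitrPr; exists (mfcoef g 0%MM).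
by rewrite mulrC -mfcoefM0 E mfcoef1 eqxx.
Qed.

Fact mfinv_out : {in [predC mfunit], mfinv =1 id}.
Proof. by move=> f /negbTE Uf; rewrite /mfinv Uf. Qed.

HB.instance Definition _ := GRing.ComNzRing_hasMulInverse.Build (mfps n R)
  mfmulV mfunitPl mfinv_out.

Lemma mfunitE f : (f \is a GRing.unit) = (mfcoef f 0%MM \is a GRing.unit).
Proof. by []. Qed.

End ComUnitRing.

(* S is the sum of the series of the F k, in the formal topology: every
   coefficient of the partial sums is eventually equal to that of S.          *)
Definition mfsums (n : nat) (R : zmodType) (F : nat -> mfps n R)
    (S : mfps n R) : Prop :=
  forall m, exists N, forall K, (N <= K)%N ->
    mfcoef (\sum_(k < K) F k) m = mfcoef S m.

Definition qnum (R : nzRingType) (m : nat) (z : R) : R := \sum_(i < m) z ^+ i.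

(* Throughout, j in [n] is represented by the ordinal j - 1 : 'I_n.           *)

Definition Des (n : nat) (p : 'S_n) : {set 'I_n} :=
  [set j : 'I_n | [exists k : 'I_n, (k == j.+1 :> nat) && (p k < p j)%N]].

(* The pair (p, c) stands for (p, eps) with eps_j = omega ^ c_j.              *)
Definition wreath (r n : nat) : finType := ('S_n * {ffun 'I_n -> 'I_r})%type.

Definition wmx (r n : nat) (F : nzRingType) (omega : F) (x : wreath r n) :
    'M[F]_n :=
  \matrix_(i, j) (if i == x.1 j then omega ^+ x.2 j else 0).

Definition opp_color (r : nat) (c : 'I_r) : 'I_r :=
  Ordinal (ltn_pmod (r - c) (leq_ltn_trans (leq0n c) (ltn_ord c))).

(* The inverse in the wreath product; see winv_mx.                            *)
Definition winv (r n : nat) (x : wreath r n) : wreath r n :=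
  ((x.1^-1)%g, [ffun k => opp_color (x.2 ((x.1^-1)%g k))]).

Lemma winv_mx (r n : nat) (F : comUnitRingType) (omega : F) (x : wreath r n) :
  omega ^+ r = 1 ->
  wmx omega x \in unitmx /\ wmx omega (winv x) = invmx (wmx omega x).
Proof.
move=> w1; have E : wmx omega (winv x) *m wmx omega x = 1%:M.
  apply/matrixP => i j; rewrite !mxE (bigD1 (x.1 j)) //= big1 => [|k ne].
    rewrite !mxE eqxx /= permK addr0 ffunE permK /=.
    case: eqP => [_|]; rewrite ?mul0r // -exprD.
    rewrite -(expr_mod _ w1) modnDml subnK 1?ltnW //.
    by rewrite modnn.
  by rewrite !mxE (negbTE ne) mulr0.
have [_ Ux] := mulmx1_unit E; split=> //.
by rewrite -[LHS]mulmx1 -(mulmxV Ux) mulmxA E mul1mx.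
Qed.

Definition clt (r n : nat) (a b : 'I_n * 'I_r) : bool :=
  (b.2 < a.2)%N || (a.2 == b.2) && (a.1 < b.1)%N.

Definition DesA (r n : nat) (x : wreath r n) : {set 'I_n} :=
  [set i : 'I_n | [exists k : 'I_n, (k == i.+1 :> nat) &&
                     clt (x.1 k, x.2 k) (x.1 i, x.2 i)]].

Definition Irn (r n : nat) : {set wreath r n} := [set x | DesA x == set0].

(* The multiset NNeg, given by its multiplicity function.                     *)
Definition NNeg (r n : nat) (x : wreath r n) (i : 'I_n) : nat := x.2 i.

Lemma NNeg_winv (r n : nat) (x : wreath r n) (i : 'I_n) :
  NNeg (winv x) (x.1 i) = ((r - x.2 i) %% r)%N.
Proof. by rewrite /NNeg /= ffunE permK. Qed.

Definition z0 (n : nat) : mfps n.+1 int := mfvar ord0.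
Definition zv (n : nat) (j : 'I_n) : mfps n.+1 int := mfvar (lift ord0 j).

(* z_0 z_{p(1)} ... z_{p(j)} *)
Definition zpre (n : nat) (p : 'S_n) (j : 'I_n) : mfps n.+1 int :=
  z0 n * \prod_(i < n | (i <= j)%N) zv (p i).

Lemma unit_den (r n : nat) (p : 'S_n) : (0 < r)%N ->
  (1 - z0 n) *
  \prod_(j < n) (1 - z0 n ^+ r * \prod_(i < n | (i <= j)%N) zv (p i) ^+ r)
    \is a GRing.unit.
Proof.
move=> r_gt0; have z0E : mfcoef (z0 n) 0%MM = 0.
  by rewrite /= eq_sym -mdeg_eq0 mdeg1.
rewrite unitrM mfunitE mfcoefB mfcoef1 eqxx z0E subr0 unitr1 /=.
apply: (big_ind (fun f : mfps n.+1 int => f \is a GRing.unit)); rewrite ?unitr1 //.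
  by move=> f g Uf Ug; rewrite unitrM Uf.
move=> j _; rewrite mfunitE mfcoefB mfcoef1 eqxx mfcoefM0.
by rewrite (mfcoefX_eq0 z0E) ?mdeg0 // mul0r subr0 unitr1.
Qed.

(* Main.v *)
Require Import Defs.
From mathcomp Require Import all_boot all_order all_algebra all_fingroup.
From mathcomp Require Import boolp mpoly zify.

(* Both sides are the indicator series of the exponents m with m_j <= m_0 for
   all j; on the left this is clear.  On the right, write
   y_j = z_0 z_{p(1)} ... z_{p(j)}.  An element of I_{r,n} is determined by the
   colors of the values 1, ..., n, so the inner sum of the products over NNeg is
   \prod_j [r]_{y_j}, which cancels against the denominator and leaves
   \prod_{j in Des p} y_j / ((1 - z_0) \prod_j (1 - y_j)).  The monomials
   z_0, y_1, ..., y_n generate a free monoid, in which the exponents of the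
   generators are the gaps m_0 - m_{p(1)}, m_{p(1)} - m_{p(2)}, ..., m_{p(n)}.
   Hence the quotient is the indicator series of the m such that
   m_0 >= m_{p(1)} >= ... >= m_{p(n)}, with a strict inequality at each descent
   of p; each m with all m_j <= m_0 satisfies this for exactly one p, the stable
   sort of its entries in decreasing order. *)

Set Implicit Arguments.
Unset Strict Implicit.
Unset Printing Implicit Defensive.

Import GRing.Theory.

Local Open Scope ring_scope.

Lemma subr1X_qnum (R : comNzRingType) (y : R) r :
  1 - y ^+ r = (1 - y) * qnum r y.
Proof. by rewrite -opprB subrX1 -mulNr opprB. Qed.

Section IndicatorSeries.
Variables (n : nat) (R : comNzRingType).
Implicit Types (u v m : 'X_{1..n}) (P Q : pred 'X_{1..n}).

Definition mfindic P : mfps n R := MFps (fun m => (P m)%:R).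

Definition mfX u : mfps n R := mfindic (pred1 u).

Lemma eq_mfindic P Q : P =1 Q -> mfindic P = mfindic Q.
Proof. by move=> eqPQ; apply/mfpsP => m /=; rewrite eqPQ. Qed.

Lemma sum_mfindic (I : finType) (A : pred I) (P : I -> pred 'X_{1..n}) Q :
    (forall m, exists c, forall i, A i && P i m = Q m && (i == c)) ->
  \sum_(i | A i) mfindic (P i) = mfindic Q.
Proof.
move=> PQ; apply/mfpsP => m; rewrite mfcoef_sum big_mkcond /=.
have [c PQc] := PQ m; rewrite (bigD1 c) //= big1 => [|i /negbTE ne_ic].
  by have := PQc c; rewrite eqxx andbT addr0; case: (A c) => /= <-.
by have := PQc i; rewrite ne_ic andbF; case: (A i) => //= ->.
Qed.

Lemma mfsums_mfindic (P : nat -> pred 'X_{1..n}) Q :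
    (forall m, exists c, forall k, P k m = Q m && (k == c)) ->
  mfsums (fun k => mfindic (P k)) (mfindic Q).
Proof.
move=> PQ m; have [c PQc] := PQ m; exists c.+1 => K lt_cK.
rewrite mfcoef_sum (bigD1 (Ordinal lt_cK)) //= big1 => [|k].
  by rewrite addr0 PQc eqxx andbT.
by rewrite -val_eqE PQc => /negbTE /= ->; rewrite andbF.
Qed.

Lemma mfcoefXM u (f : mfps n R) m :
  mfcoef (mfX u * f) m = if (u <= m)%MM then mfcoef f (m - u)%MM else 0.
Proof.
rewrite mfcoefM; case: ifP => [le_um | /negP nle_um]; last first.
  rewrite big1 // => -[k1 k2] /= /eqP Em.
  have [E1|_] := eqVneq; last by rewrite mul0r.
  by case: nle_um; rewrite [X in (_ <= X)%MM]Em E1 lem_addr.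
have lt_u : (mdeg u < (mdeg m).+1)%N.
  by rewrite ltnS -(submK le_um) mdegD leq_addl.
have lt_mBu : (mdeg (m - u)%MM < (mdeg m).+1)%N.
  by rewrite ltnS -[leqRHS](congr1 mdeg (submK le_um)) mdegD leq_addr.
rewrite (bigD1 (BMultinom lt_u, BMultinom lt_mBu)) /=; last first.
  by rewrite addmC submK.
rewrite eqxx mul1r big1 ?addr0 // => -[k1 k2] /= /andP[/eqP Em ne_k].
have [E1|_] := eqVneq; last by rewrite mul0r.
case/eqP: ne_k; congr (_, _); apply: val_inj => //=.
by rewrite [X in (X - u)%MM]Em E1 addmC addmK.
Qed.

Lemma mfX_mfindic u P :
  mfX u * mfindic P = mfindic (fun m => (u <= m)%MM && P (m - u)%MM).
Proof. by apply/mfpsP => m; rewrite mfcoefXM /=; case: ifP. Qed.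

Lemma mul_1BX_mfindic u P : (forall m, P m -> P (m + u)%MM) ->
  (1 - mfX u) * mfindic P =
  mfindic (fun m => P m && ~~ ((u <= m)%MM && P (m - u)%MM)).
Proof.
move=> stabP; rewrite mulrBl mul1r mfX_mfindic; apply/mfpsP => m.
rewrite mfcoefB /=; have [/andP[le_um Pmu]|_] := boolP (_ && _); last first.
  by rewrite subr0 andbT.
by rewrite -(submK le_um) stabP // subrr.
Qed.

Lemma mfX0 : mfX 0%MM = 1. Proof. by []. Qed.

Lemma mfXD u v : mfX (u + v)%MM = mfX u * mfX v.
Proof.
rewrite mfX_mfindic; apply: eq_mfindic => m /=.
apply/eqP/andP => [-> | [le_um /eqP <-]]; first by rewrite lem_addr addmC addmK.
by rewrite addmC submK.
Qed.

Lemma mfX_sum (I : Type) (s : seq I) (P : pred I) (F : I -> 'X_{1..n}) :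
  mfX (\sum_(i <- s | P i) F i)%MM = \prod_(i <- s | P i) mfX (F i).
Proof. exact: (big_morph mfX mfXD mfX0). Qed.

Lemma mfXMn u k : mfX (u *+ k)%MM = mfX u ^+ k.
Proof.
by elim: k => [|k IHk]; rewrite ?mulm0n // mulmS mfXD IHk exprS.
Qed.

Lemma prod_sum_mfvar b (P : 'I_n -> pred nat) :
  \prod_i \sum_(e < b.+1 | P i e) mfvar i ^+ e =
  mfindic (fun m => [forall i, (m i <= b)%N && P i (m i)]).
Proof.
pose mnm_of (f : {ffun 'I_n -> 'I_b.+1}) := [multinom f i : nat | i < n].
rewrite bigA_distr_big_dep.
rewrite (eq_bigr (fun f => mfX (mnm_of f))) => [|f _]; last first.
  rewrite [mnm_of f]multinomUE_id mfX_sum.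
  by apply: eq_bigr => i _; rewrite mfXMn mnmE.
apply: sum_mfindic => m; exists [ffun i => inord (m i)] => f /=.
apply/andP/andP => [[/familyP Pf /eqP ->] | [/forallP Pm /eqP ->]]; split.
- by apply/forallP => i; rewrite mnmE -ltnS ltn_ord; apply: Pf.
- by apply/eqP/ffunP => i; rewrite ffunE mnmE inord_val.
- apply/familyP => i; have /andP[le_b Pi] := Pm i.
  by rewrite ffunE unfold_in /= inordK.
- apply/eqP/mnmP => i; have /andP[le_b _] := Pm i.
  by rewrite mnmE ffunE inordK.
Qed.

End IndicatorSeries.

Section FreeSubmonoid.
Variables (n : nat) (R : comNzRingType) (I : finType) (u : I -> 'X_{1..n}).
Implicit Types (a b : I -> nat) (m : 'X_{1..n}).

Definition mnm_comb a : 'X_{1..n} := (\sum_i u i *+ a i)%MM.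

Definition mnm_free : Prop := forall a b, mnm_comb a = mnm_comb b -> a =1 b.

Lemma eq_mnm_comb a b : a =1 b -> mnm_comb a = mnm_comb b.
Proof. by move=> eq_ab; apply: eq_bigr => i _; rewrite eq_ab. Qed.

Lemma mnm_comb0 a : (forall i, a i = 0%N) -> mnm_comb a = 0%MM.
Proof. by move=> a0; rewrite /mnm_comb big1 // => i _; rewrite a0 mulm0n. Qed.

Lemma mnm_combD a b :
  mnm_comb (fun i => a i + b i)%N = (mnm_comb a + mnm_comb b)%MM.
Proof.
rewrite -big_split /=; apply: eq_bigr => i _; apply/mnmP => j.
by rewrite mnmDE !mulmnE mulnDr.
Qed.

Lemma mnm_comb_delta i : mnm_comb (fun j => nat_of_bool (j == i)) = u i.
Proof.
rewrite /mnm_comb (bigD1 i) //= eqxx big1 ?addm0 // => j /negbTE ->.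
by rewrite mulm0n.
Qed.

Definition mnm_span m : bool := `[< exists a, m = mnm_comb a >].

Definition mnm_span_avoiding (s : seq I) m : bool :=
  `[< exists2 a, m = mnm_comb a & {in s, forall i, a i = 0%N} >].

Lemma mnm_span_avoiding_cons i s m : mnm_free -> i \notin s ->
  mnm_span_avoiding (i :: s) m =
  mnm_span_avoiding s m &&
    ~~ ((u i <= m)%MM && mnm_span_avoiding s (m - u i)%MM).
Proof.
move=> free_u s'i; apply/asboolP/andP => [[a Em a0] | []].
  split; first by apply/asboolP; exists a => // j js; rewrite a0 ?inE ?js ?orbT.
  apply/negP => /andP[le_um /asboolP[b Emu _]].
  have: mnm_comb a = mnm_comb (fun j => b j + (j == i))%N.
    by rewrite mnm_combD mnm_comb_delta -Emu submK.
  by move/free_u/(_ i); rewrite a0 ?mem_head // eqxx addn1.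
move=> /asboolP[a Em a0] not_shift; exists a => // j.
rewrite inE => /predU1P[-> {j} | /a0 //]; apply/eqP; apply: contraNT not_shift.
rewrite -lt0n => ai_gt0; pose b j := (a j - (j == i))%N.
have Em' : m = (mnm_comb b + u i)%MM.
  rewrite Em -mnm_comb_delta -mnm_combD; apply: eq_mnm_comb => j.
  by rewrite subnK //; case: eqP => // ->.
rewrite Em' lem_addl addmK; apply/asboolP; exists b => // j js.
by rewrite /b a0.
Qed.

(* Multiplying by 1 - X^(u i) removes the combinations in which u i occurs. *)
Lemma prod_1BX_mfindic_span : mnm_free ->
  \prod_i (1 - mfX R (u i)) * mfindic R mnm_span = 1.
Proof.
move=> free_u.
have avoid_nil : mnm_span_avoiding [::] =1 mnm_span.
  by move=> m; apply/asbool_equiv_eq; split=> [[a ? _] | [a ?]]; exists a.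
have prod_avoid s : uniq s ->
    \prod_(i <- s) (1 - mfX R (u i)) * mfindic R (mnm_span_avoiding [::]) =
    mfindic R (mnm_span_avoiding s).
  elim: s => [|i s IHs] /=; first by rewrite big_nil mul1r.
  case/andP=> s'i uniq_s; rewrite big_cons -mulrA IHs // mul_1BX_mfindic.
    by apply: eq_mfindic => m; rewrite mnm_span_avoiding_cons.
  move=> m /asboolP[a -> a0]; apply/asboolP.
  exists (fun j => a j + (j == i))%N; first by rewrite mnm_combD mnm_comb_delta.
  by move=> j js; rewrite a0 //; case: eqP js s'i => // -> ->.
rewrite -(eq_mfindic R avoid_nil) prod_avoid ?index_enum_uniq // -mfX0.
apply: eq_mfindic => m /=; apply/asboolP/eqP => [[a -> a0] | ->].
  by rewrite mnm_comb0 // => i; rewrite a0 ?mem_index_enum.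
by exists (fun=> 0%N) => //; rewrite mnm_comb0.
Qed.

End FreeSubmonoid.

Section PrefixMonomials.
Variables (N : nat) (q : 'S_N).
Implicit Types (a d : 'I_N -> nat) (m : 'X_{1..N}).

Definition prefix_mnm (k : 'I_N) : 'X_{1..N} :=
  (\sum_(i < N | (i <= k)%N) U_(q i))%MM.

(* The word reads 0 from position N on, so its last gap is its last letter. *)
Definition mword m (i : nat) : nat := nth 0%N [multinom m (q j) | j < N] i.

Lemma mwordE m (i : 'I_N) : mword m i = m (q i).
Proof. by rewrite /mword -mnm_nth mnmE. Qed.

Lemma mword_default m i : (N <= i)%N -> mword m i = 0%N.
Proof. by move=> le_Ni; rewrite /mword nth_default // size_tuple. Qed.

Lemma eq_mword m1 m2 : (forall i, mword m1 i = mword m2 i) -> m1 = m2.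
Proof.
by move=> eq_w; apply/mnmP => j; rewrite -[j](permKV q) -!mwordE.
Qed.

Lemma prefix_mnmE k i : prefix_mnm k (q i) = (i <= k)%N.
Proof.
rewrite mnm_sumE big_mkcond (bigD1 i) //= mnm1E eqxx big1 ?addn0.
  by case: leq.
by move=> j /negbTE ne_ji; rewrite mnm1E (inj_eq perm_inj) ne_ji if_same.
Qed.

Lemma mword_comb a i :
  mword (mnm_comb prefix_mnm a) i = (\sum_(k < N | (i <= k)%N) a k)%N.
Proof.
have [lt_iN | le_Ni] := ltnP i N; last first.
  rewrite mword_default // big1 // => k le_ik.
  by have := leq_trans le_Ni le_ik; rewrite leqNgt ltn_ord.
rewrite (mwordE _ (Ordinal lt_iN)) mnm_sumE [RHS]big_mkcond /=.
by apply: eq_bigr => k _; rewrite mulmnE prefix_mnmE; case: leq; rewrite ?mul1n.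
Qed.

(* The coefficients are the gaps of the word, since only the prefixes of length
   greater than i involve the i-th letter. *)
Lemma mnm_comb_prefixP a m :
  m = mnm_comb prefix_mnm a <->
  (forall i : 'I_N, mword m i = (mword m i.+1 + a i)%N).
Proof.
have comb_gap (i : 'I_N) :
    mword (mnm_comb prefix_mnm a) i =
    (mword (mnm_comb prefix_mnm a) i.+1 + a i)%N.
  rewrite !mword_comb (bigD1 i) //= addnC; congr (_ + _)%N.
  by apply: eq_bigl => k; rewrite ltn_neqAle eq_sym andbC.
split=> [-> // | gap]; apply: eq_mword => i.
have [k le_Nik] := ubnP (N - i); elim: k i le_Nik => // k IHk i lt_Nik.
have [lt_iN | le_Ni] := ltnP i N; last by rewrite !mword_default.
by rewrite (gap (Ordinal lt_iN)) (comb_gap (Ordinal lt_iN)) IHk //=; lia.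
Qed.

Lemma prefix_mnm_free : mnm_free prefix_mnm.
Proof.
move=> a b eq_ab i; have /mnm_comb_prefixP/(_ i) gap_b := eq_ab.
have /mnm_comb_prefixP/(_ i) gap_a := erefl (mnm_comb prefix_mnm a).
exact: addnI (etrans (esym gap_a) gap_b).
Qed.

Definition gaps_geq d m : bool :=
  [forall i : 'I_N, mword m i.+1 + d i <= mword m i]%N.

Lemma gaps_geqP d m :
  gaps_geq d m <->
  exists a, m = mnm_comb prefix_mnm (fun i => d i + a i)%N.
Proof.
split=> [/forallP gap | [a /mnm_comb_prefixP gap]]; last first.
  by apply/forallP => i; rewrite gap leq_add2l leq_addr.
exists (fun i : 'I_N => mword m i - (mword m i.+1 + d i))%N.
by apply/mnm_comb_prefixP => i; rewrite addnA subnKC.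
Qed.

Lemma mword_anti d m i k :
  gaps_geq d m -> (i <= k)%N -> (mword m k <= mword m i)%N.
Proof.
move=> /gaps_geqP[a ->] le_ik; rewrite !mword_comb.
rewrite [leqLHS]big_mkcond [leqRHS]big_mkcond; apply: leq_sum => j _.
by case: ifP => // le_kj; rewrite (leq_trans le_ik).
Qed.

Lemma prod_1BX_mfindic_gaps (R : comNzRingType) d :
  \prod_i (1 - mfX R (prefix_mnm i)) * mfindic R (gaps_geq d) =
  mfX R (mnm_comb prefix_mnm d).
Proof.
rewrite -[RHS]mulr1 -[in RHS](prod_1BX_mfindic_span R prefix_mnm_free) mulrCA.
congr (_ * _); rewrite mfX_mfindic; apply: eq_mfindic => m.
apply/idP/andP => [/gaps_geqP[a ->] | [le_vm /asboolP[a Ea]]].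
  rewrite mnm_combD lem_addr; split=> //; apply/asboolP; exists a.
  by rewrite addmC addmK.
by apply/gaps_geqP; exists a; rewrite mnm_combD -Ea addmC submK.
Qed.

End PrefixMonomials.

Section Sorting.
Variable n : nat.
Implicit Types (lt : rel 'I_n) (p : 'S_n).

Definition sorts lt p : bool := sorted lt (codom p).

Lemma sortsP lt p :
  reflect (forall i k : 'I_n, k = i.+1 :> nat -> lt (p i) (p k)) (sorts lt p).
Proof.
have nth_p x0 (i : 'I_n) : nth x0 (codom p) i = p i.
  by rewrite (nth_map i) ?size_enum_ord // nth_ord_enum.
apply: (iffP idP) => [/sortedP sorted_p i k Ek | lt_p].
  have := sorted_p (p i) i; rewrite size_codom card_ord -Ek ltn_ord !nth_p.
  exact.
rewrite /sorts; case codom_p: (codom p) => [//|x0 s]; rewrite -codom_p.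
apply/(sortedP x0) => i; rewrite size_codom card_ord => lt_i.
have := lt_p (Ordinal (ltnW lt_i)) (Ordinal lt_i) erefl.
by rewrite -!(nth_p x0).
Qed.

Section StrictTotalOrder.
Variable lt : rel 'I_n.
Hypotheses (lt_irr : irreflexive lt) (lt_trans : transitive lt).
Hypothesis lt_total : forall a b, a != b -> lt a b || lt b a.

Lemma sorts_inj p p' : sorts lt p -> sorts lt p' -> p = p'.
Proof.
move=> sp sp'; have eq_codom : codom p = codom p'.
  apply: (irr_sorted_eq lt_trans lt_irr sp sp') => x.
  by rewrite -[in LHS](permKV p x) -[in RHS](permKV p' x) !codom_f.
by apply/permP => i; move/eq_in_map: eq_codom; apply; rewrite mem_enum.
Qed.

Definition order_rank (a : 'I_n) : nat := #|[pred b | lt b a]|.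

Lemma order_rank_ltn a b : lt a b -> (order_rank a < order_rank b)%N.
Proof.
move=> lt_ab; apply/proper_card/properP; split.
  by apply/subsetP => c; rewrite !inE => /lt_trans; apply.
by exists a; rewrite !inE ?lt_irr.
Qed.

Lemma order_rank_ltn_ord a : (order_rank a < n)%N.
Proof.
rewrite -[ltnRHS]card_ord; apply/proper_card/properP.
by split; [apply/subsetP | exists a; rewrite !inE ?lt_irr].
Qed.

Lemma order_rank_inj : injective (fun a => Ordinal (order_rank_ltn_ord a)).
Proof.
move=> a b [eq_rank]; apply/eqP/negPn/negP => /lt_total.
by case/orP=> /order_rank_ltn; rewrite eq_rank ltnn.
Qed.

Lemma sorts_exists : exists p, sorts lt p.
Proof.
exists (perm order_rank_inj)^-1%g; apply/sortsP => i k Ek; set p := perm _.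
have rankV (j : 'I_n) : order_rank ((p^-1)%g j) = j.
  by rewrite -[in RHS](permKV p j) [p _ in RHS]permE.
have ne_ik : i != k by rewrite -val_eqE /= Ek neq_ltn ltnSn.
have := @lt_total ((p^-1)%g i) ((p^-1)%g k).
rewrite (inj_eq perm_inj) => /(_ ne_ik).
by case/orP=> // /order_rank_ltn; rewrite !rankV Ek => /ltnW; rewrite ltnn.
Qed.

Lemma sorts_unique : exists p0, sorts lt =1 pred1 p0.
Proof.
have [p0 sp0] := sorts_exists; exists p0 => p /=.
by apply/idP/eqP => [sp | -> //]; apply: sorts_inj.
Qed.

End StrictTotalOrder.
End Sorting.

Section StableOrder.
Variables (n : nat) (f : 'I_n -> nat).

Definition before (a b : 'I_n) : bool :=
  (f b < f a)%N || (f b == f a) && (a < b)%N.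

Lemma before_irr : irreflexive before.
Proof. by move=> a; rewrite /before; lia. Qed.

Lemma before_trans : transitive before.
Proof. by move=> b a c; rewrite /before; lia. Qed.

Lemma before_negb a b : a != b -> before a b = ~~ before b a.
Proof. by rewrite -val_eqE /before /=; lia. Qed.

Lemma before_leq a b : a != b -> before a b = (f b + (b < a) <= f a)%N.
Proof. by rewrite -val_eqE /before /=; lia. Qed.

Lemma sorts_before_unique : exists p0, sorts before =1 pred1 p0.
Proof.
apply: sorts_unique before_irr before_trans _ => a b /before_negb ->.
by rewrite orNb.
Qed.

End StableOrder.

Lemma opp_colorK r : involutive (@opp_color r).
Proof.
case=> c lt_cr; apply: val_inj => /=; case: c lt_cr => [|c] lt_cr.
  by rewrite subn0 modnn subn0 modnn.
by rewrite (@modn_small (r - c.+1)) ?modn_small; lia.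
Qed.

Lemma winvK r n : involutive (@winv r n).
Proof.
case=> p c; rewrite /winv /= invgK; congr (_, _).
by apply/ffunP => k; rewrite !ffunE /= permK opp_colorK.
Qed.

Lemma clt_before r n (c : 'I_n -> 'I_r) a b :
  clt (a, c a) (b, c b) = before c a b.
Proof. by rewrite /clt /= -val_eqE /= eq_sym. Qed.

Lemma perm_neqS n (p : 'S_n) (i k : 'I_n) : k = i.+1 :> nat -> p i != p k.
Proof. by move=> Ek; rewrite (inj_eq perm_inj) -val_eqE /= Ek; lia. Qed.

Lemma mem_winv_Irn r n (p : 'S_n) (c : {ffun 'I_n -> 'I_r}) :
  (winv (p, c) \in Irn r n) = sorts (before (fun v => opp_color (c v))) p^-1%g.
Proof.
rewrite inE; apply/eqP/sortsP => [DesA0 i k Ek | sorted_p].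
  have /setP/(_ i) := DesA0; rewrite !inE => /negbT/existsPn/(_ k).
  rewrite Ek eqxx /= !ffunE (clt_before (fun v => opp_color (c v))).
  by rewrite -before_negb ?perm_neqS.
apply/setP => i; rewrite !inE; apply/existsP => -[k /andP[/eqP Ek]].
rewrite /= !ffunE (clt_before (fun v => opp_color (c v))).
by rewrite before_negb ?sorted_p // eq_sym perm_neqS.
Qed.

(* Inverting turns the sum into one over the colors of the values 1, ..., n, for
   each of which exactly one underlying permutation has no descent. *)
Lemma sum_Irn_NNeg r n (R : comNzRingType) (y : 'I_n -> R) :
  \sum_(x in Irn r n) \prod_(j < n) y j ^+ NNeg (winv x) j =
  \prod_(j < n) qnum r (y j).
Proof.
rewrite /qnum bigA_distr_bigA /= (reindex_inj (inv_inj (@winvK r n))) /=.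
under eq_bigr => x _ do rewrite winvK /NNeg.
rewrite -(pair_big_dep xpredT (fun p c => winv (p, c) \in Irn r n)
  (fun _ c => \prod_j y j ^+ (c : {ffun 'I_n -> 'I_r}) j)) /=.
rewrite (exchange_big_dep xpredT) //=; apply: eq_bigr => c _.
have [p0 sorts_p0] := sorts_before_unique (fun v => opp_color (c v)).
rewrite (big_pred1 (p0^-1)%g) // => p /=.
by rewrite mem_winv_Irn sorts_p0 /= (canF_eq invgK).
Qed.

Lemma zpreX n (p : 'S_n) (j : 'I_n) r :
  zpre p j ^+ r = z0 n ^+ r * \prod_(i < n | (i <= j)%N) zv (p i) ^+ r.
Proof. by rewrite exprMn prodrXl. Qed.

Lemma mem_Des_succ n (p : 'S_n) (i k : 'I_n) :
  k = i.+1 :> nat -> (i \in Des p) = (p k < p i)%N.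
Proof.
move=> Ek; rewrite inE; apply/existsP/idP => [[k' /andP[/eqP Ek']] | lt_p].
  by have -> : k' = k by apply: val_inj; rewrite /= Ek Ek'.
by exists k; rewrite Ek eqxx.
Qed.

Lemma mem_Des_last n (p : 'S_n) (i : 'I_n) : (n <= i.+1)%N -> i \notin Des p.
Proof.
move=> le_ni; rewrite inE; apply/existsP => -[k /andP[/eqP Ek _]].
by have := ltn_ord k; rewrite Ek ltnNge le_ni.
Qed.

Section DescentCone.
Variables (n : nat) (p : 'S_n).

(* Position 0 holds the variable z_0 and position i > 0 holds z_{p(i)}. *)
Definition z_order : 'S_n.+1 := lift_perm ord0 ord0 p.

Definition Des_gap (i : 'I_n.+1) : nat :=
  if unlift ord0 i is Some j then j \in Des p else 0%N.

Lemma mfX_prefix_mnm0 : mfX int (prefix_mnm z_order ord0) = z0 n.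
Proof.
rewrite /prefix_mnm big_mkcond big_ord_recl /= big1 ?addm0 => [|j _ //].
by rewrite lift_perm_id.
Qed.

Lemma mfX_prefix_mnm_lift j :
  mfX int (prefix_mnm z_order (lift ord0 j)) = zpre p j.
Proof.
rewrite /prefix_mnm big_mkcond big_ord_recl /= mfXD lift_perm_id; congr (_ * _).
rewrite -big_mkcond mfX_sum; apply: eq_big => [// | i _].
by rewrite lift_perm_lift.
Qed.

Lemma mfX_comb_Des_gap :
  mfX int (mnm_comb (prefix_mnm z_order) Des_gap) = \prod_(j in Des p) zpre p j.
Proof.
rewrite /mnm_comb big_ord_recl /Des_gap unlift_none mulm0n add0m mfX_sum.
rewrite [RHS]big_mkcond; apply: eq_bigr => j _.
by rewrite liftK mfXMn mfX_prefix_mnm_lift; case: (j \in Des p).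
Qed.

Lemma prod_1BX_prefix_mnm :
  \prod_i (1 - mfX int (prefix_mnm z_order i)) =
  (1 - z0 n) * \prod_(j < n) (1 - zpre p j).
Proof.
rewrite big_ord_recl mfX_prefix_mnm0; congr (_ * _).
by apply: eq_bigr => j _; rewrite mfX_prefix_mnm_lift.
Qed.

Lemma sum_Irn_quotient r : (0 < r)%N ->
  \sum_(x in Irn r n)
    ((\prod_(j in Des p) zpre p j) *
     (\prod_(j < n) zpre p j ^+ NNeg (winv x) j)) /
    ((1 - z0 n) *
     \prod_(j < n) (1 - z0 n ^+ r * \prod_(i < n | (i <= j)%N) zv (p i) ^+ r)) =
  mfindic int (gaps_geq z_order Des_gap).
Proof.
move=> r_gt0; have den_unit := unit_den p r_gt0.
rewrite -mulr_suml -mulr_sumr sum_Irn_NNeg -mfX_comb_Des_gap.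
rewrite -prod_1BX_mfindic_gaps prod_1BX_prefix_mnm.
apply: (canLR (mulrK den_unit)); rewrite mulrAC mulrC; congr (_ * _).
rewrite -mulrA -big_split; congr (_ * _); apply: eq_bigr => j _ /=.
by rewrite -zpreX subr1X_qnum.
Qed.

Lemma mword_z_order0 m : mword z_order m 0 = m ord0.
Proof. by rewrite (mwordE _ _ ord0) lift_perm_id. Qed.

Lemma mword_z_orderS m (j : 'I_n) : mword z_order m j.+1 = m (lift ord0 (p j)).
Proof. by rewrite -lift0 mwordE lift_perm_lift. Qed.

Lemma gaps_geq_Des_gapE m :
  gaps_geq z_order Des_gap m =
  [forall i, m i <= m ord0]%N && sorts (before (fun j => m (lift ord0 j))) p.
Proof.
apply/idP/andP => [gap | [/forallP le_m0 /sortsP sorted_p]].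
  split.
    apply/forallP => i; rewrite -[i](permKV z_order) -mwordE -mword_z_order0.
    exact: mword_anti gap _.
  apply/sortsP => i k Ek; have /forallP/(_ (lift ord0 i)) := gap.
  rewrite /Des_gap liftK lift0 mword_z_orderS -Ek mword_z_orderS.
  by rewrite (mem_Des_succ p Ek) before_leq ?perm_neqS.
apply/forallP => i; rewrite /Des_gap.
case: (unliftP ord0 i) => [j|] ->; last first.
  rewrite addn0 mword_z_order0.
  have [n0 | n_gt0] := posnP n; first by rewrite mword_default // n0.
  by rewrite (mword_z_orderS _ (Ordinal n_gt0)).
rewrite lift0 mword_z_orderS; have [lt_jn | le_nj] := ltnP j.+1 n.
  pose k := Ordinal lt_jn.
  rewrite (mword_z_orderS _ k) (@mem_Des_succ _ p j k) //.
  by have := sorted_p j k erefl; rewrite before_leq ?perm_neqS.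
by rewrite mword_default // (negbTE (mem_Des_last p le_nj)).
Qed.

End DescentCone.

Lemma sum_descent_cones n :
  \sum_(p : 'S_n) mfindic int (gaps_geq (z_order p) (Des_gap p)) =
  mfindic int (fun m => [forall i, m i <= m ord0]%N).
Proof.
apply: sum_mfindic => m.
have [p0 sorts_p0] := sorts_before_unique (fun j => m (lift ord0 j)).
by exists p0 => p; rewrite gaps_geq_Des_gapE sorts_p0.
Qed.

Lemma prod_qnum_zv n k :
  \prod_(j < n) qnum k.+1 (zv j) * z0 n ^+ k =
  mfindic int (fun m => [forall i, m i <= m ord0]%N && (k == m ord0)).
Proof.
pose P (i : 'I_n.+1) (e : nat) := (i == ord0) ==> (e == k).
transitivity (\prod_i \sum_(e < k.+1 | P i e) mfvar i ^+ e : mfps n.+1 int).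
  rewrite big_ord_recl mulrC; congr (_ * _).
  by rewrite (big_pred1 ord_max) // => e; rewrite /P eqxx -val_eqE.
rewrite prod_sum_mfvar; apply: eq_mfindic => m.
apply/forallP/andP => [le_m | [/forallP le_m /eqP k_m0] i].
  have /andP[_ /eqP m0] := le_m ord0.
  by rewrite m0 eqxx; split=> //; apply/forallP => i; case/andP: (le_m i).
by rewrite /P k_m0 le_m; apply/implyP => /eqP ->.
Qed.

Theorem theorem5p14 (r n : nat) (hr : (0 < r)%N) (hn : (0 < n)%N) :
  mfsums
    (fun k : nat => (\prod_(j < n) qnum k.+1 (zv j)) * z0 n ^+ k)
    (\sum_(p : 'S_n) \sum_(x in Irn r n)
       ((\prod_(j in Des p) zpre p j) *
        (\prod_(j < n) zpre p j ^+ NNeg (winv x) j)) /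
       ((1 - z0 n) *
        \prod_(j < n)
          (1 - z0 n ^+ r * \prod_(i < n | (i <= j)%N) zv (p i) ^+ r))).
Proof.
rewrite (funext (@prod_qnum_zv n)).
rewrite (eq_bigr _ (fun p _ => sum_Irn_quotient p hr)) sum_descent_cones.
by apply: mfsums_mfindic => m; exists (m ord0).
Qed.
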